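(* Let $\alpha,\beta>0$ be constants, let $n>1$ be an integer, $T>0$, $\tau=T/n$, and let $u_0,u_1,\dots,u_n\in D(\mathcal L_0)$ satisfy the homogeneous nonlinear three-layer scheme $$\frac{u_{k+1}-2u_k+u_{k-1}}{\tau^2}-\frac12\left(\alpha+\frac{\beta}{2}\iint_\Omega\left(|\nabla u_{k+1}|^2+|\nabla u_{k-1}|^2\right)dx\,dy\right)\left(\Delta u_{k+1}+\Delta u_{k-1}\right)=0,\qquad k=1,2,\dots,n-1 .$$ For $k=1,\dots,n$ define $$\widetilde E_{2,k}=\mathcal K_k+\frac{\alpha}{2}\left(V_{k-1}+V_k\right)+\frac{\beta}{2}\left(V_{k-1}^2+V_k^2\right).$$ Then $\widetilde E_{2,k+1}=\widetilde E_{2,k}=\widetilde E_{2,1}$ for every $k=1,2,\dots,n-1$.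
   Context: $\Omega\subset\mathbb R^2$ is a bounded convex domain (in particular with Lipschitz boundary). $D(\mathcal L_0)=\{u\in C^2(\overline\Omega): u|_{\partial\Omega}=0\}$ (real-valued functions). For a sequence $(u_k)$, $$\mathcal K_k=\frac12\iint_\Omega\left(\frac{u_k-u_{k-1}}{\tau}\right)^2dx\,dy,\qquad V_k=\frac12\iint_\Omega|\nabla u_k|^2\,dx\,dy .$$ *)

(* Defs.v *)
From HB Require Import structures.
From mathcomp Require Import all_boot all_order all_algebra.
From mathcomp Require Import all_classical all_reals all_analysis.
Set Implicit Arguments.
Unset Strict Implicit.
Unset Printing Implicit Defensive.
Import Order.TTheory GRing.Theory Num.Theory.
Import numFieldNormedType.Exports.
Local Open Scope classical_set_scope.
Local Open Scope ring_scope.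

(* A domain is a nonempty connected open set; connectedness follows from
   convexity. The norm on R * R is the max norm, which has the same bounded
   and open sets as the Euclidean norm. *)
Definition bounded_convex_domain (R : realType) (Omega : set (R * R)) : Prop :=
  [/\ open Omega, Omega !=set0, bounded_set Omega & convex_set Omega].

Definition topological_boundary (T : topologicalType) (A : set T) : set T :=
  closure A `\` interior A.

Definition partial_x (R : realType) (u : R * R -> R) : R * R -> R :=
  fun p => 'D_((1, 0) : R * R) u p.

Definition partial_y (R : realType) (u : R * R -> R) : R * R -> R :=
  fun p => 'D_((0, 1) : R * R) u p.

Definition laplacian (R : realType) (u : R * R -> R) : R * R -> R :=
  fun p => partial_x (partial_x u) p + partial_y (partial_y u) p.

(* Euclidean |grad u|^2, written out because the library norm on R * R is the
   max norm. *)
Definition grad_norm_sq (R : realType) (u : R * R -> R) : R * R -> R :=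
  fun p => partial_x u p ^+ 2 + partial_y u p ^+ 2.

Definition extends_continuously (R : realType) (Omega : set (R * R))
    (f : R * R -> R) : Prop :=
  exists2 g : R * R -> R,
    {within closure Omega, continuous g} & forall p, Omega p -> f p = g p.

(* For open Omega, the partial derivatives at a point of Omega only depend on
   the values in Omega, so the next two predicates do not constrain f off
   Omega. *)
Definition C1_up_to_boundary (R : realType) (Omega : set (R * R))
    (f : R * R -> R) : Prop :=
  [/\ extends_continuously Omega f,
      forall p, Omega p -> derivable f p (1, 0),
      forall p, Omega p -> derivable f p (0, 1),
      extends_continuously Omega (partial_x f) &
      extends_continuously Omega (partial_y f)].

Definition C2_up_to_boundary (R : realType) (Omega : set (R * R))
    (f : R * R -> R) : Prop :=
  [/\ C1_up_to_boundary Omega f,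
      C1_up_to_boundary Omega (partial_x f) &
      C1_up_to_boundary Omega (partial_y f)].

(* An element of C^2 of the closure is represented by a total function u on
   R * R; continuity of u itself on the closure makes its values on the boundary
   the traces of its values inside. Values off the closure are irrelevant. *)
Definition dom_L0 (R : realType) (Omega : set (R * R)) : set (R * R -> R) :=
  [set u | [/\ {within closure Omega, continuous u},
               C2_up_to_boundary Omega u &
               forall p, topological_boundary Omega p -> u p = 0]].

Definition integral2 (R : realType) (Omega : set (R * R)) (f : R * R -> R) : R :=
  \int[(@lebesgue_measure R \x @lebesgue_measure R)%E]_(p in Omega) f p.

Definition kinetic (R : realType) (Omega : set (R * R)) (tau : R)
    (u : nat -> R * R -> R) (k : nat) : R :=
  2^-1 * integral2 Omega (fun p => ((u k p - u k.-1 p) / tau) ^+ 2).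

Definition potential (R : realType) (Omega : set (R * R))
    (u : nat -> R * R -> R) (k : nat) : R :=
  2^-1 * integral2 Omega (grad_norm_sq (u k)).

Definition energy2 (R : realType) (Omega : set (R * R)) (alpha beta tau : R)
    (u : nat -> R * R -> R) (k : nat) : R :=
  kinetic Omega tau u k
  + alpha / 2 * (potential Omega u k.-1 + potential Omega u k)
  + beta / 2 * (potential Omega u k.-1 ^+ 2 + potential Omega u k ^+ 2).

(* Main.v *)
Require Import Defs.
From HB Require Import structures.
From mathcomp Require Import all_boot all_order all_algebra.
From mathcomp Require Import all_classical all_reals all_analysis.
From mathcomp Require Import measurable_realfun ring lra.
Set Implicit Arguments.
Unset Strict Implicit.
Unset Printing Implicit Defensive.
Import Order.TTheory GRing.Theory Num.Theory.
Import numFieldNormedType.Exports.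
Local Open Scope classical_set_scope.
Local Open Scope ring_scope.

(** Multiply the scheme at step [k] by [u_{k+1} - u_{k-1}] and integrate. The
    difference quotient becomes exact, because
    (u_{k+1} - 2 u_k + u_{k-1}) (u_{k+1} - u_{k-1})
      = (u_{k+1} - u_k)^2 - (u_k - u_{k-1})^2,
    so it contributes twice the increment of the kinetic energy. By Green's first
    identity ([green_first_identity]) the cross terms cancel in
    ∫ (u_{k+1} - u_{k-1}) (Δu_{k+1} + Δu_{k-1})
      = ∫ |∇u_{k-1}|^2 - ∫ |∇u_{k+1}|^2 = 2 (V_{k-1} - V_{k+1})
    ([integral_diff_laplacian_sum]), and the nonlocal coefficient equals
    α + β (V_{k+1} + V_{k-1}), so that the product telescopes into the increments
    of α V / 2 and β V^2 / 2 ([energy_step]).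

    Green's identity is proved by slicing. If a line parallel to an axis meets a
    bounded open convex set, it does so in a bounded open interval whose end
    points lie on the boundary. If [a] vanishes on the boundary, then by the
    fundamental theorem of calculus the derivative of [a * b] along the line has
    integral 0 over this interval
    ([line_integration_by_parts]). Fubini's theorem, applied once for each
    coordinate with a first partial derivative in the place of [b], gives the
    identity. All functions that occur extend continuously to the compact closure
    of the domain, hence are bounded and integrable
    ([extends_continuously_integrable]). *)

(** * Measurability and integrability in the plane *)

(** The sigma-algebra of the product of two copies of [R] is generated by
    rectangles, so an open set has to be written as a countable union of them:
    the rational boxes that it contains. *)
Lemma open_measurable_prod (R : realType) (U : set (R * R)) :
  open U -> measurable (U : set (measurableTypeR R * measurableTypeR R)).
Proof.
move=> oU.
pose box (i : (rat * rat) * (rat * rat)) : set (R * R) :=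
  `]ratr i.1.1, ratr i.1.2[ `*` `]ratr i.2.1, ratr i.2.2[.
have -> : U = \bigcup_i (if `[< box i `<=` U >] then box i else set0).
  apply/seteqP; split => [[x y] Uxy|p [i _]]; last first.
    by case: asboolP => // sub; exact: sub.
  have /nbhs_ballP[e /= e0 sub] : nbhs (x, y) U by exact: open_nbhs_nbhs.
  have [a aP] := @rat_in_itvoo R (x - e) x ltac:(lra).
  have [b bP] := @rat_in_itvoo R x (x + e) ltac:(lra).
  have [c cP] := @rat_in_itvoo R (y - e) y ltac:(lra).
  have [d dP] := @rat_in_itvoo R y (y + e) ltac:(lra).
  move: aP bP cP dP; rewrite !in_itv /=.
  move=> /andP[a1 a2] /andP[b1 b2] /andP[c1 c2] /andP[d1 d2].
  exists ((a, b), (c, d)) => //; case: asboolP => [_|].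
    by split; rewrite /= in_itv /=; apply/andP; split.
  case=> -[s t] [/=]; rewrite !in_itv /= => /andP[s1 s2] /andP[t1 t2].
  apply: sub; split; rewrite /ball /= ltr_norml; lra.
apply: countable_bigcupT_measurable => // i.
by case: ifP => // _; apply: measurableX; exact: measurable_itv.
Qed.

(** The norm of a pair is the maximum of the norms of its components. *)
Lemma bounded_set_box (R : realType) (U : set (R * R)) :
  bounded_set U -> exists M : R, U `<=` `[- M, M] `*` `[- M, M].
Proof.
move=> [M [_ bU]]; exists (M + 1) => p Up.
have : `|p| <= M + 1 by apply: (bU (M + 1)) => //; rewrite ltrDl.
rewrite prod_normE ge_max => /andP[p1 p2].
by split; rewrite /= in_itv /= -ler_norml.
Qed.

Lemma bounded_closure_compact (R : realType) (U : set (R * R)) :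
  bounded_set U -> compact (closure U).
Proof.
move=> /bounded_set_box[M sub].
have cbox : compact (`[- M, M] `*` `[- M, M] : set (R * R)).
  by apply: compact_setX; exact: segment_compact.
apply: (subclosed_compact _ cbox); first exact: closed_closure.
rewrite closureE; apply: smallest_sub => //.
by apply: compact_closed => //; exact: norm_hausdorff.
Qed.

Lemma bounded_measure_lty (R : realType) (U : set (R * R)) :
  open U -> bounded_set U ->
  ((@lebesgue_measure R \x @lebesgue_measure R)%E U < +oo)%E.
Proof.
move=> oU /bounded_set_box[M]; set I := `[- M, M]%classic => sub.
have mI : measurable (I : set (measurableTypeR R)) by exact: measurable_itv.
have finI : (@lebesgue_measure R I < +oo)%E.
  by rewrite /I lebesgue_measure_itv /=; case: ifP; rewrite ?ltry.
apply: (@le_lt_trans _ _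
    ((@lebesgue_measure R \x @lebesgue_measure R)%E (I `*` I))).
  apply: le_measure => //; rewrite inE; first exact: open_measurable_prod.
  exact: measurableX.
rewrite product_measure1E //; apply: lte_mul_pinfty => //.
by rewrite ge0_fin_numE.
Qed.

Lemma continuous_measurable_prod (R : realType) (U : set (R * R))
    (f : R * R -> R) : open U -> {within U, continuous f} ->
  measurable_fun (U : set (measurableTypeR R * measurableTypeR R)) f.
Proof.
move=> oU; rewrite (continuous_open_subspace f oU) => cf.
apply: (measurability _ (RGenOInfty.measurableE R)) => _ [_ [a ->] <-].
apply: open_measurable_prod; rewrite openE => p [Up fp].
apply: filterI; first exact: open_nbhs_nbhs.
apply: (cf p); first exact/mem_set.
by apply: open_nbhs_nbhs; split => //; exact: interval_open.
Qed.

(** The continuous extension is bounded on the compact closure, and [U] has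
    finite measure. *)
Lemma extends_continuously_integrable (R : realType) (U : set (R * R))
    (f : R * R -> R) : open U -> bounded_set U -> extends_continuously U f ->
  (@lebesgue_measure R \x @lebesgue_measure R)%E.-integrable U (EFin \o f).
Proof.
move=> oU bU [g cg fg]; have mU := open_measurable_prod oU.
apply: (eq_integrable mU (EFin \o g)).
  by move=> p /set_mem Up; rewrite /= fg.
apply: measurable_bounded_integrable => //.
- exact: bounded_measure_lty.
- apply: continuous_measurable_prod => //.
  exact: (continuous_subspaceW (@subset_closure _ U) cg).
- have /compact_bounded[M [Mr bM]] :=
    continuous_compact cg (bounded_closure_compact bU).
  exists M; split => // x Mx p Up; apply: (bM x Mx).
  by exists p => //; exact: subset_closure.
Qed.

(** * The fundamental theorem of calculus on a bounded open interval *)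

Lemma subset_itvcc_closure_itvoo (R : realType) (a b : R) : a < b ->
  `[a, b]%classic `<=` closure `]a, b[%classic.
Proof.
move=> ab x /=; rewrite in_itv /= => /andP[].
rewrite le_eqVlt => /predU1P[<- _|ax].
  move=> B aB; apply: (@filter_ex _ (a^'+)); apply: filterI.
    by near=> t; rewrite /= in_itv /=; apply/andP; split.
  exact: cvg_at_right_filter aB.
rewrite le_eqVlt => /predU1P[->|xb]; last first.
  by apply: subset_closure; rewrite /= in_itv /= ax.
move=> B bB; apply: (@filter_ex _ (b^'-)); apply: filterI.
  by near=> t; rewrite /= in_itv /=; apply/andP; split.
exact: cvg_at_left_filter bB.
Unshelve. all: by end_near. Qed.

(** [S] is the interval between its infimum and its supremum. Both lie in the
    closure of [S] but not in [S], so [F] takes the same value 0 there. The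
    continuity on the closure is what the fundamental theorem of calculus needs
    on the closed interval. *)
Lemma integral_derive_eq0 (R : realType) (S : set R) (F f : R -> R) :
  open S -> has_lbound S -> has_ubound S -> is_interval S ->
  {within closure S, continuous F} -> {within closure S, continuous f} ->
  (forall x, S x -> is_derive x 1 F (f x)) ->
  (forall x, closure S x -> ~ S x -> F x = 0) ->
  (\int[@lebesgue_measure R]_(x in S) (f x)%:E = 0)%E.
Proof.
move=> oS lS uS iS cF cf dF F0.
have := interval_bounded_interior iS lS uS; rewrite ((interior_id _).1 oS).
set a := inf S; set b := sup S => SE.
have {}SE : S = `]a, b[%classic.
  by rewrite SE; apply/seteqP; split=> x /=; rewrite in_itv.
have [ba|ab] := leP b a.
  by rewrite SE set_itv_ge ?integral_set0 // bnd_simp -leNgt.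
rewrite SE in oS cF cf F0 dF *.
have sub := subset_itvcc_closure_itvoo ab.
have {}cF := continuous_subspaceW sub cF.
have {}cf := continuous_subspaceW sub cf.
have mf : measurable_fun (`]a, b[%classic : set (measurableTypeR R)) f.
  apply: open_continuous_measurable_fun => // x /set_mem.
  by have [cfoo _ _] := (continuous_within_itvP f ab).1 cf; exact: cfoo.
rewrite -(@integral_itv_bndoo _ a b _ true false); last exact/measurable_EFinP.
have [cFoo cFa cFb] := (continuous_within_itvP F ab).1 cF.
rewrite (@continuous_FTC2 _ f F a b ab cf).
- rewrite !F0 ?subee //.
  + by apply: sub; rewrite /= in_itv /= lexx ltW.
  + by rewrite /= in_itv /= ltxx.
  + by apply: sub; rewrite /= in_itv /= lexx ltW.
  + by rewrite /= in_itv /= ltxx andbF.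
- by split => // x xab; have [] := dF x xab.
- by move=> x xab; rewrite derive1E; have [] := dF x xab.
Qed.

(** * Integration by parts along a line *)

(** A line with direction [e] is described by the equation
    [l (h + t) = h *: e + l t] rather than by a formula, so that the lemmas below
    apply verbatim to [fun x => (x, y)] and [fun y => (x, y)]. *)
Lemma line_continuous (R : realType) (e : R * R) (l : R -> R * R) :
  (forall h t, l (h + t) = h *: e + l t) -> continuous l.
Proof.
move=> lE; have -> : l = (fun t => t *: e + l 0).
  by apply/funext => t; rewrite -lE addr0.
move=> t; apply: cvgD; last exact: cvg_cst.
by apply: cvgZr_tmp; exact: cvg_id.
Qed.

(** The difference quotients of [f] in the direction [e] are literally those of
    the function [f \o l] of one variable. *)
Lemma derivable_line (R : realType) (e : R * R) (l : R -> R * R)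
    (f : R * R -> R) t : (forall h t, l (h + t) = h *: e + l t) ->
  derivable f (l t) e -> is_derive t 1 (f \o l) ('D_e f (l t)).
Proof.
move=> lE df.
have quotE : (fun h => h^-1 *: ((f \o shift (l t)) (h *: e) - f (l t))) =
    (fun h => h^-1 *: ((f \o l \o shift t) (h *: 1) - (f \o l) t)).
  by apply/funext => h /=; rewrite /shift /= -lE [h *: 1]mulr1.
by apply: DeriveDef; rewrite /derivable /derive -quotE.
Qed.

Lemma convex_line_interval (R : realType) (U : set (R * R)) (e : R * R)
    (l : R -> R * R) : convex_set U ->
  (forall h t, l (h + t) = h *: e + l t) -> is_interval (l @^-1` U).
Proof.
move=> cU lE x y Ux Uy z /andP[xz zy].
(* The barycentric weight below is undefined for x = y. *)
have [xy|xy] := eqVneq x y.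
  by rewrite (_ : z = x) //; apply/le_anti; rewrite {1}xy zy xz.
have xy0 : 0 < y - x by rewrite subr_gt0 lt_neqAle xy (le_trans xz zy).
pose s := (y - z) / (y - x).
have s0 : 0 <= s by rewrite divr_ge0 // ?(ltW xy0) // subr_ge0.
have s1 : s <= 1 by rewrite ler_pdivrMr // mul1r lerD2l lerN2.
have /set_mem := cU (l x) (l y) (Itv01 s0 s1) (mem_set Ux) (mem_set Uy).
rewrite /conv /= /convex.conv /=.
suff -> : s *: l x + unstable.onem s *: l y = l z by [].
have lE0 t : l t = t *: e + l 0 by rewrite -lE addr0.
rewrite (lE0 x) (lE0 y) (lE0 z) /unstable.onem.
rewrite !scalerDr !scalerA addrACA -!scalerDl addrC subrKC scale1r addrC.
congr (_ *: _ + _); rewrite /s; field.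
by rewrite gt_eqF.
Qed.

Lemma bounded_line (R : realType) (U : set (R * R)) (e : R * R)
    (l : R -> R * R) : bounded_set U -> e != 0 ->
  (forall h t, l (h + t) = h *: e + l t) ->
  has_lbound (l @^-1` U) /\ has_ubound (l @^-1` U).
Proof.
move=> [M [_ bU]] e0 lE.
suff [K KP] : exists K : R, forall t, U (l t) -> `|t| <= K.
  by split; [exists (- K)|exists K] => t /KP; rewrite ler_norml => /andP[].
exists ((M + 1 + `|l 0|) / `|e|) => t Ut.
rewrite ler_pdivlMr ?normr_gt0 // -normrZ.
have -> : t *: e = l t - l 0 by rewrite -[in l t](addr0 t) lE addrK.
apply: (le_trans (ler_normB _ _)); rewrite lerD2r.
by apply: (bU (M + 1)) => //; rewrite ltrDl.
Qed.

Lemma within_continuous_preimage (T T' : topologicalType) (R : realType)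
    (l : T -> T') (U : set T') (f : T' -> R) : continuous l ->
  {within closure U, continuous f} ->
  {within closure (l @^-1` U), continuous (f \o l)}.
Proof.
move=> cl cf.
have sub : closure (l @^-1` U) `<=` l @^-1` closure U.
  move=> x clx B /cl Bx; have [y [Uy By]] := clx _ Bx.
  by exists (l y).
apply: (continuous_subspaceW sub).
apply/subspace_continuousP => x Ux.
have /subspace_continuousP/(_ _ Ux) := cf.
apply: cvg_comp => B; rewrite /within /= => BU.
exact: cl BU.
Qed.

(** The integrand is the derivative of [a * b] along the line, and [a] vanishes
    at the end points of the slice, which lie on the boundary of [U]. Only a
    continuous extension of [b] is available at these points, hence the
    primitive used in the proof is the product of [a] with that extension; it
    agrees with [a * b] near every point of the slice. *)
Lemma line_integration_by_parts (R : realType) (U : set (R * R)) (e : R * R)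
    (l : R -> R * R) (a b : R * R -> R) :
  bounded_convex_domain U -> e != 0 ->
  (forall h t, l (h + t) = h *: e + l t) ->
  {within closure U, continuous a} ->
  (forall p, topological_boundary U p -> a p = 0) ->
  (forall p, U p -> derivable a p e) ->
  (forall p, U p -> derivable b p e) ->
  extends_continuously U ('D_e a) -> extends_continuously U b ->
  extends_continuously U ('D_e b) ->
  (\int[@lebesgue_measure R]_(t in l @^-1` U)
    (a (l t) * 'D_e b (l t) + 'D_e a (l t) * b (l t))%:E = 0)%E.
Proof.
move=> [oU _ bU cU] e0 lE ca a0 da db [da' cda' daE] [b' cb' bE] [db' cdb' dbE].
have cl := line_continuous lE.
have oS : open (l @^-1` U) by apply: open_comp => // x _; exact: cl.
have [lS uS] := bounded_line bU e0 lE.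
under eq_integral => t /set_mem Ut do rewrite (dbE _ Ut) (daE _ Ut) (bE _ Ut).
apply: (@integral_derive_eq0 R (l @^-1` U) (fun t => a (l t) * b' (l t))
  (fun t => a (l t) * db' (l t) + da' (l t) * b' (l t)) oS lS uS).
- exact: convex_line_interval lE.
- move=> t; apply: continuousM; exact: (within_continuous_preimage cl).
- move=> t; apply: cvgD; apply: continuousM;
    exact: (within_continuous_preimage cl).
- move=> t Ut; rewrite -(dbE _ Ut) -(daE _ Ut) -(bE _ Ut).
  apply: (@near_eq_is_derive _ _ _ ((a \o l) * (b \o l))).
    have : nbhs t (l @^-1` U) by exact: open_nbhs_nbhs.
    by apply: filterS => s Us; rewrite -(bE _ Us).
  have Da := derivable_line lE (da _ Ut); have Db := derivable_line lE (db _ Ut).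
  rewrite [X in is_derive _ _ _ X](_ : _ = (a \o l) t *: 'D_e b (l t) +
     (b \o l) t *: 'D_e a (l t)); last by rewrite [X in _ + X]mulrC.
  exact: is_deriveM.
- move=> t clt nUt; rewrite a0 ?mul0r //; split.
    by move=> B /cl Bt; have [y [Uy By]] := clt _ Bt; exists (l y).
  by rewrite (interior_id _).1.
Qed.

(** * Functions that extend continuously to the closure, and their integrals *)

Section ExtendsContinuously.
Variables (R : realType) (U : set (R * R)).
Implicit Types f g : R * R -> R.

Lemma extends_continuouslyD f g : extends_continuously U f ->
  extends_continuously U g -> extends_continuously U (fun p => f p + g p).
Proof.
move=> [f' cf fE] [g' cg gE]; exists (fun p => f' p + g' p).
  by move=> p; apply: cvgD; [exact: cf|exact: cg].
by move=> p Up; rewrite fE // gE.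
Qed.

Lemma extends_continuouslyM f g : extends_continuously U f ->
  extends_continuously U g -> extends_continuously U (fun p => f p * g p).
Proof.
move=> [f' cf fE] [g' cg gE]; exists (fun p => f' p * g' p).
  by move=> p; apply: continuousM; [exact: cf|exact: cg].
by move=> p Up; rewrite fE // gE.
Qed.

Lemma extends_continuously_cst c : extends_continuously U (fun=> c).
Proof. by exists (fun=> c) => // p; exact: cst_continuous. Qed.

Lemma extends_continuouslyB f g : extends_continuously U f ->
  extends_continuously U g -> extends_continuously U (fun p => f p - g p).
Proof.
move=> cf cg; apply: extends_continuouslyD => //.
rewrite (_ : (fun p => - g p) = (fun p => -1 * g p)); last first.
  by apply/funext => p; rewrite mulN1r.
exact: (extends_continuouslyM (extends_continuously_cst _) cg).
Qed.

Hypotheses (oU : open U) (bU : bounded_set U).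

Lemma integral2D f g : extends_continuously U f -> extends_continuously U g ->
  integral2 U (fun p => f p + g p) = integral2 U f + integral2 U g.
Proof.
move=> cf cg; apply: RintegralD; first exact: open_measurable_prod.
- exact: extends_continuously_integrable.
- exact: extends_continuously_integrable.
Qed.

Lemma integral2B f g : extends_continuously U f -> extends_continuously U g ->
  integral2 U (fun p => f p - g p) = integral2 U f - integral2 U g.
Proof.
move=> cf cg; apply: RintegralB; first exact: open_measurable_prod.
- exact: extends_continuously_integrable.
- exact: extends_continuously_integrable.
Qed.

Lemma integral2Zl c f : extends_continuously U f ->
  integral2 U (fun p => c * f p) = c * integral2 U f.
Proof.
move=> cf; apply: RintegralZl; first exact: open_measurable_prod.
exact: extends_continuously_integrable.
Qed.

Lemma eq_integral2 f g : (forall p, U p -> f p = g p) ->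
  integral2 U f = integral2 U g.
Proof. by move=> fg; apply: eq_Rintegral => p /set_mem; exact: fg. Qed.

(** Fubini's theorem for the extension of [f] by 0 outside [U]. *)
Lemma integral2_xslices_eq0 f : extends_continuously U f ->
  (forall y, \int[@lebesgue_measure R]_(x in (fun x => (x, y)) @^-1` U)
     (f (x, y))%:E = 0)%E ->
  integral2 U f = 0.
Proof.
move=> cf f0; have mU := open_measurable_prod oU.
rewrite /integral2 /Rintegral integral_mkcond -integral21_prod_meas1; last first.
  by apply/(integrable_mkcond _ mU); exact: extends_continuously_integrable.
rewrite integral0_eq // => y _; rewrite /fubini_G -[RHS](f0 y).
by rewrite [RHS]integral_mkcond; apply: eq_integral => x _; rewrite !patchE.
Qed.

Lemma integral2_yslices_eq0 f : extends_continuously U f ->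
  (forall x, \int[@lebesgue_measure R]_(y in (fun y => (x, y)) @^-1` U)
     (f (x, y))%:E = 0)%E ->
  integral2 U f = 0.
Proof.
move=> cf f0; have mU := open_measurable_prod oU.
rewrite /integral2 /Rintegral integral_mkcond -integral12_prod_meas1; last first.
  by apply/(integrable_mkcond _ mU); exact: extends_continuously_integrable.
rewrite integral0_eq // => x _; rewrite /fubini_F -[RHS](f0 x).
by rewrite [RHS]integral_mkcond; apply: eq_integral => y _; rewrite !patchE.
Qed.

End ExtendsContinuously.

(** * Green's identity and the energy balance *)

Section Green.
Variables (R : realType) (U : set (R * R)).
Hypothesis domU : bounded_convex_domain U.
Implicit Types a b : R * R -> R.

Let oU : open U. Proof. by case: domU. Qed.
Let bU : bounded_set U. Proof. by case: domU. Qed.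

Definition grad_dot a b (p : R * R) : R :=
  partial_x a p * partial_x b p + partial_y a p * partial_y b p.

Lemma grad_dot_diag a : grad_dot a a = grad_norm_sq a.
Proof. by apply/funext => p; rewrite /grad_norm_sq /grad_dot !expr2. Qed.

Lemma dom_L0_extends a : dom_L0 U a ->
  [/\ extends_continuously U a, extends_continuously U (partial_x a),
      extends_continuously U (partial_y a) &
      extends_continuously U (laplacian a)].
Proof.
move=> [ca [[ea _ _ ex ey] [_ _ _ exx _] [_ _ _ _ eyy]] _]; split => //.
exact: extends_continuouslyD.
Qed.

Lemma extends_continuously_grad_dot a b : dom_L0 U a -> dom_L0 U b ->
  extends_continuously U (grad_dot a b).
Proof.
move=> /dom_L0_extends[_ ax ay _] /dom_L0_extends[_ bx b_y _].
by apply: extends_continuouslyD; exact: extends_continuouslyM.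
Qed.

(** No boundary term appears because [a] vanishes on the boundary. The two sides
    differ by the integrals of the derivatives of [a * partial_x b] along
    horizontal lines and of [a * partial_y b] along vertical lines, which
    vanish slice by slice. *)
Lemma green_first_identity a b : dom_L0 U a -> dom_L0 U b ->
  integral2 U (fun p => a p * laplacian b p) = - integral2 U (grad_dot a b).
Proof.
move=> La Lb.
have [ea eax eay _] := dom_L0_extends La.
have [_ ebx eby elb] := dom_L0_extends Lb.
have [ca [[_ dax day _ _] _ _] a0] := La.
have [_ [_ [_ dbxx _ ebxx _] [_ _ dbyy _ ebyy]] _] := Lb.
pose X p := a p * partial_x (partial_x b) p + partial_x a p * partial_x b p.
pose Y p := a p * partial_y (partial_y b) p + partial_y a p * partial_y b p.
have eX : extends_continuously U X.
  by apply: extends_continuouslyD; exact: extends_continuouslyM.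
have eY : extends_continuously U Y.
  by apply: extends_continuouslyD; exact: extends_continuouslyM.
have X0 : integral2 U X = 0.
  apply: integral2_xslices_eq0 => // y.
  have e0 : (1, 0) != 0 :> R * R by apply/eqP => -[/eqP]; rewrite oner_eq0.
  have lE h t :
      (fun x => (x, y)) (h + t) = h *: (1, 0) + (fun x => (x, y)) t :> R * R.
    by congr pair; rewrite /= ?scaler0 ?add0r // [h *: 1]mulr1.
  have H := @line_integration_by_parts R U (1, 0) (fun x => (x, y)) a
    (partial_x b) domU e0 lE ca a0 dax dbxx eax ebx ebxx.
  exact: H.
have Y0 : integral2 U Y = 0.
  apply: integral2_yslices_eq0 => // x.
  have e0 : (0, 1) != 0 :> R * R by apply/eqP => -[/eqP]; rewrite oner_eq0.
  have lE h t :
      (fun y => (x, y)) (h + t) = h *: (0, 1) + (fun y => (x, y)) t :> R * R.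
    by congr pair; rewrite /= ?scaler0 ?add0r // [h *: 1]mulr1.
  have H := @line_integration_by_parts R U (0, 1) (fun y => (x, y)) a
    (partial_y b) domU e0 lE ca a0 day dbyy eay eby ebyy.
  exact: H.
have eL := extends_continuouslyM ea elb.
have eG := extends_continuously_grad_dot La Lb.
suff XY : integral2 U (fun p => a p * laplacian b p + grad_dot a b p) =
    integral2 U (fun p => X p + Y p).
  apply/eqP; rewrite -addr_eq0; apply/eqP.
  apply: (etrans (esym (integral2D oU bU eL eG))); apply: (etrans XY).
  apply: (etrans (integral2D oU bU eX eY)).
  exact: (etrans (congr2 +%R X0 Y0) (addr0 0)).
apply: eq_integral2 => p _; rewrite /X /Y /laplacian /grad_dot.
by rewrite mulrDr addrACA.
Qed.

(** The cross terms produced by Green's identity cancel because [grad_dot] is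
    symmetric. *)
Lemma integral_diff_laplacian_sum a b : dom_L0 U a -> dom_L0 U b ->
  integral2 U (fun p => (a p - b p) * (laplacian a p + laplacian b p)) =
  integral2 U (grad_norm_sq b) - integral2 U (grad_norm_sq a).
Proof.
move=> La Lb.
have [ea _ _ ela] := dom_L0_extends La; have [eb _ _ elb] := dom_L0_extends Lb.
have eaa := extends_continuouslyM ea ela.
have eab := extends_continuouslyM ea elb.
have eba := extends_continuouslyM eb ela.
have ebb := extends_continuouslyM eb elb.
have -> : integral2 U (fun p => (a p - b p) * (laplacian a p + laplacian b p)) =
    integral2 U (fun p => (a p * laplacian a p + a p * laplacian b p) -
                          (b p * laplacian a p + b p * laplacian b p)).
  apply: eq_integral2 => p _.
  by move: (a p) (b p) (laplacian a p) (laplacian b p) => x y z w; ring.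
rewrite (integral2B oU bU (extends_continuouslyD eaa eab)
  (extends_continuouslyD eba ebb)).
rewrite (integral2D oU bU eaa eab) (integral2D oU bU eba ebb).
transitivity (- integral2 U (grad_dot a a) + - integral2 U (grad_dot a b) -
    (- integral2 U (grad_dot b a) + - integral2 U (grad_dot b b))).
  exact: (congr2 (fun x y => x - y)
    (congr2 +%R (green_first_identity La La) (green_first_identity La Lb))
    (congr2 +%R (green_first_identity Lb La) (green_first_identity Lb Lb))).
have dotC : integral2 U (grad_dot a b) = integral2 U (grad_dot b a).
  by apply: eq_integral2 => p _; congr (_ + _); rewrite mulrC.
rewrite dotC -!grad_dot_diag.
move: (integral2 U (grad_dot a a)) (integral2 U (grad_dot b a))
  (integral2 U (grad_dot b b)) => x y z; ring.
Qed.

Lemma extends_continuously_grad_norm_sq a : dom_L0 U a ->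
  extends_continuously U (grad_norm_sq a).
Proof.
by move=> La; rewrite -grad_dot_diag; exact: extends_continuously_grad_dot.
Qed.

(** Testing against [u k.+2 - u k] turns the second difference into a difference
    of squares, and the nonlocal coefficient times the difference of the
    potential energies into a difference of quadratic polynomials in them. *)
Lemma energy_step alpha beta tau (u : nat -> R * R -> R) k :
  dom_L0 U (u k.+2) -> dom_L0 U (u k.+1) -> dom_L0 U (u k) ->
  (forall p, U p ->
     (u k.+2 p - 2 * u k.+1 p + u k p) / tau ^+ 2
     - 2^-1 * (alpha + beta / 2 * integral2 U
          (fun q => grad_norm_sq (u k.+2) q + grad_norm_sq (u k) q))
       * (laplacian (u k.+2) p + laplacian (u k) p) = 0) ->
  energy2 U alpha beta tau u k.+2 = energy2 U alpha beta tau u k.+1.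
Proof.
move=> L2 L1 L0 scheme.
have [e2 _ _ el2] := dom_L0_extends L2.
have [e1 _ _ _] := dom_L0_extends L1.
have [e0 _ _ el0] := dom_L0_extends L0.
have ek f g : extends_continuously U f -> extends_continuously U g ->
    extends_continuously U (fun p => ((f p - g p) / tau) ^+ 2).
  move=> ef eg; have efg : extends_continuously U (fun p => (f p - g p) / tau).
    apply: extends_continuouslyM; last exact: extends_continuously_cst.
    exact: extends_continuouslyB.
  exact: (extends_continuouslyM efg efg).
rewrite (integral2D oU bU (extends_continuously_grad_norm_sq L2)
  (extends_continuously_grad_norm_sq L0)) in scheme.
set G2 := integral2 U (grad_norm_sq (u k.+2)) in scheme.
set G0 := integral2 U (grad_norm_sq (u k)) in scheme.
(* The nonlocal coefficient, equal to α + β (V_{k+2} + V_k). *)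
pose q := alpha + beta / 2 * (G2 + G0).
have kin : integral2 U (fun p => ((u k.+2 p - u k.+1 p) / tau) ^+ 2) -
    integral2 U (fun p => ((u k.+1 p - u k p) / tau) ^+ 2) =
    2^-1 * q * (G0 - G2).
  rewrite -(integral2B oU bU (ek _ _ e2 e1) (ek _ _ e1 e0)).
  rewrite -(integral_diff_laplacian_sum L2 L0) -(integral2Zl oU bU _
    (extends_continuouslyM (extends_continuouslyB e2 e0)
      (extends_continuouslyD el2 el0))).
  apply: eq_integral2 => p /scheme; rewrite -/q !exprMn exprVn.
  move: (u k.+2 p) (u k.+1 p) (u k p) (laplacian (u k.+2) p)
    (laplacian (u k) p) (tau ^+ 2)^-1 q => x y z v w t r /subr0_eq eqp.
  by rewrite mulrCA -eqp; ring.
rewrite /energy2 /kinetic /potential /= -/G2 -/G0.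
set G1 := integral2 U (grad_norm_sq (u k.+1)).
set K2 := integral2 _ _ in kin *; set K1 := integral2 _ _ in kin *.
have {kin scheme} : K2 - K1 = 2^-1 * q * (G0 - G2) := kin.
rewrite {}/q; move: K2 K1 G2 G1 G0 => x y g2 g1 g0 /(canRL (subrK _)) ->.
by field.
Qed.

End Green.

Theorem mainTheorem2 (R : realType) (Omega : set (R * R))
    (hOmega : bounded_convex_domain Omega)
    (alpha beta : R) (halpha : 0 < alpha) (hbeta : 0 < beta)
    (n : nat) (hn : (1 < n)%N) (T tau : R) (hT : 0 < T) (htau : tau = T / n%:R)
    (u : nat -> R * R -> R)
    (hu : forall k : nat, (k <= n)%N -> dom_L0 Omega (u k))
    (hscheme : forall k : nat, (1 <= k <= n.-1)%N ->
       forall p : R * R, Omega p ->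
         (u k.+1 p - 2 * u k p + u k.-1 p) / tau ^+ 2
         - 2^-1 * (alpha + beta / 2 * integral2 Omega
              (fun q => grad_norm_sq (u k.+1) q + grad_norm_sq (u k.-1) q))
           * (laplacian (u k.+1) p + laplacian (u k.-1) p) = 0) :
  forall k : nat, (1 <= k <= n.-1)%N ->
    energy2 Omega alpha beta tau u k.+1 = energy2 Omega alpha beta tau u k /\
    energy2 Omega alpha beta tau u k = energy2 Omega alpha beta tau u 1.
Proof.
have step k : (k.+1 <= n.-1)%N ->
    energy2 Omega alpha beta tau u k.+2 = energy2 Omega alpha beta tau u k.+1.
  move=> kn; have k2n : (k.+2 <= n)%N by rewrite -(ltn_predK hn) ltnS.
  have k1n : (k.+1 <= n)%N := ltnW k2n.
  exact: (energy_step hOmega (hu _ k2n) (hu _ k1n) (hu _ (ltnW k1n))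
    (hscheme k.+1 kn)).
have from1 k : (k.+1 <= n.-1)%N ->
    energy2 Omega alpha beta tau u k.+1 = energy2 Omega alpha beta tau u 1.
  elim: k => [_|k IHk kn]; first reflexivity.
  exact: (etrans (step _ (ltnW kn)) (IHk (ltnW kn))).
case=> [|k] kn; first by exfalso.
exact: (conj (step k kn) (from1 k kn)).
Qed.
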